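(* Let $G=(V,E)$ be a finite simple connected $4$-valent graph (every vertex has degree $4$) which is also $4$-edge-connected, and let $\mathbf{p}:V\to\mathbb{R}^2$ be a configuration in general position, i.e. the images under $\mathbf{p}$ of any three points of $V$ do not lie on the same line. Then $$r(G(\mathbf{p}))\geq \frac{5|V|-4}{3}.$$
   Context: All graphs are finite and simple. A graph is called $k$-edge-connected ($k\in\mathbb{N}$) if it remains connected upon removing any $k-1$ edges. For a graph $G=(V,E)$ and a map $\mathbf{p}:V\to\mathbb{R}^2$ (a planar realization, or configuration), the rigidity matrix $R(\mathbf{p})$ is the $|E|\times 2|V|$ real matrix whose row indexed by an edge $e_{ij}$ joining $v_i$ and $v_j$ has $\mathbf{p}(v_i)-\mathbf{p}(v_j)$ in the two columns belonging to $v_i$, $\mathbf{p}(v_j)-\mathbf{p}(v_i)$ in the two columns belonging to $v_j$, and $0$ elsewhere. Its rank is denoted $r(G(\mathbf{p}))$. *)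

(* Defs.v *)
From mathcomp Require Import all_boot all_order all_algebra.
From mathcomp Require Import reals.

Set Implicit Arguments.
Unset Strict Implicit.
Unset Printing Implicit Defensive.

Import GRing.Theory.
Local Open Scope ring_scope.

(* A finite simple graph on V is a symmetric irreflexive relation e : rel V;
   its edges are the two-element sets [set x; y] such that e x y. *)
Section Graphs.
Variable V : finType.
Implicit Types (e : rel V) (F : {set {set V}}).

Definition edges e : {set {set V}} :=
  [set f | [exists x, exists y, e x y && (f == [set x; y])]].

Definition valent (k : nat) e : Prop :=
  forall x, #|[set y | e x y]| = k.

Definition graph_connected e : Prop := forall x y, connect e x y.

Definition del_edges e F : rel V :=
  [rel x y | e x y && ([set x; y] \notin F)].

(* "#|F|.+1 = k" is "#|F| = k - 1" without truncated subtraction at k = 0. *)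
Definition edge_connected (k : nat) e : Prop :=
  forall F, F \subset edges e -> #|F|.+1 = k -> graph_connected (del_edges e F).

End Graphs.

Section Rigidity.
Variables (R : realType) (V : finType).
Implicit Types (e : rel V) (p : V -> 'rV[R]_2).

Definition collinear (u v w : 'rV[R]_2) : Prop :=
  exists a d : 'rV[R]_2, d != 0 /\
    forall q, q \in [:: u; v; w] -> exists t : R, q = a + t *: d.

(* p is not assumed injective. *)
Definition general_position p : Prop :=
  forall x y z : V, uniq [:: x; y; z] -> ~ collinear (p x) (p y) (p z).

(* The two entries, in the columns of v, of the row indexed by f.  For an edge
   f containing v the sum has a single term, at the other end of f. *)
Definition rigidity_block p (f : {set V}) (v : V) : 'rV[R]_2 :=
  if v \in f then \sum_(w in f :\ v) (p v - p w) else 0.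

Lemma rigidity_blockE p (x y v : V) : x != y ->
  rigidity_block p [set x; y] v =
  if v == x then p x - p y else if v == y then p y - p x else 0.
Proof.
move=> nxy; rewrite /rigidity_block !inE.
case: (eqVneq v x) => [->|nvx] /=.
  rewrite (big_pred1 y) // => w; rewrite !inE.
  by case: (eqVneq w x) => [->|_] //=; rewrite (negbTE nxy).
case: (eqVneq v y) => [->|//].
rewrite (big_pred1 x) // => w; rewrite !inE.
by case: (eqVneq w y) => [->|_] /=; rewrite ?orbF // eq_sym (negbTE nxy).
Qed.

(* mxvec lays out the two coordinates of each vertex in consecutive columns. *)
Definition rigidity_matrix e p : 'M[R]_(#|edges e|, #|V| * 2) :=
  \matrix_(i < #|edges e|)
    mxvec (\matrix_(j < #|V|) rigidity_block p (enum_val i) (enum_val j)).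

End Rigidity.

(* Main.v *)
Require Import Defs.
From mathcomp Require Import all_boot all_order all_algebra.
From mathcomp Require Import reals.
From mathcomp Require Import ring lra zify.
Set Implicit Arguments.
Unset Strict Implicit.
Unset Printing Implicit Defensive.
Import Order.TTheory GRing.Theory Num.Theory.
Local Open Scope ring_scope.

(** Write [n] for the number of vertices.  A 4-valent graph has [2 n] edges, so
    the claim is that the stresses, that is, the left kernel of the rigidity
    matrix, form a space of dimension at most [(n + 4) / 3].  It is enough to
    find at most [(n + 4) / 3] edges such that a stress vanishing on them is
    zero ([card_edges_le_rank]).

    The geometric input is [stress_small_cut].  In a stressed framework any set
    of vertices is in equilibrium under the forces carried by its edge cut, and
    in general position two edges span different lines; hence a stress with at
    most two nonzero values on a cut vanishes on that cut.  So a subgraph with a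
    cut of at most two edges can be split along it for free, and each further
    edge of a cut costs one forced edge ([forceable_split]).

    What remains is counting, done in [exists_forceable_bound].  Take a proper
    set [X] of vertices.  While it has cuts of at most two edges, split it.  Once
    it has none, some vertex of [X] has an edge leaving [X], hence exactly three
    neighbours in [X] unless it is alone; forcing one of its edges detaches it.
    If [X] without that vertex later falls into parts [P], each [P] has at least
    three edges to the rest of [X], and this pays for the forced edge: with
    [g(P) = 2 e(P) - 3 #|P| + 3], the inequality [g(X) >= 3 + sum of g(P)]
    holds, so [X] needs at most [g(X) / 3] forced edges.  For the whole graph,
    two forced edges detach a first vertex [x]; the parts of the rest have cuts
    of at least four edges, which bounds the sum of their [g] by [n - 2].  The
    total is at most [2 + (n - 2) / 3]. *)

(** * Edge counts and cuts *)

Lemma exists_subset_card (T : finType) (C : {set T}) k :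
  (k <= #|C|)%N -> exists2 S : {set T}, S \subset C & #|S| = k.
Proof.
move=> kC; exists [set:: take k (enum C)].
  by apply/subsetP=> z; rewrite inE => /mem_take; rewrite mem_enum.
rewrite cardsE (card_uniqP (take_uniq _ (enum_uniq _))).
by rewrite size_takel // -cardE.
Qed.

Section Cuts.
Variables (V : finType) (e : rel V).
Implicit Types (A B C U X Y Z : {set V}) (x y w : V).

(** Edges are counted as ordered pairs, so [narcs X X] is twice the number of
    edges inside [X], and [narcs X (~: X)] is the size of the edge cut. *)
Definition arcs A B : {set V * V} :=
  [set z | [&& z.1 \in A, z.2 \in B & e z.1 z.2]].

Definition narcs A B : nat := #|arcs A B|.

Lemma narcs_setIDl C A B :
  narcs A B = (narcs (A :&: C) B + narcs (A :\: C) B)%N.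
Proof.
rewrite /narcs -(cardsID [set z | z.1 \in C]); congr (_ + _)%N;
  by apply: eq_card => z; rewrite !inE; case: (z.1 \in A); case: (z.1 \in C);
     rewrite ?andbT ?andbF.
Qed.

Lemma narcs_setIDr C A B :
  narcs A B = (narcs A (B :&: C) + narcs A (B :\: C))%N.
Proof.
rewrite /narcs -(cardsID [set z | z.2 \in C]); congr (_ + _)%N;
  by apply: eq_card => z; rewrite !inE;
     case: (z.1 \in A); case: (z.2 \in B); case: (z.2 \in C);
     rewrite ?andbT ?andbF.
Qed.

Lemma leq_narcsr A B B' : B \subset B' -> (narcs A B <= narcs A B')%N.
Proof.
by move=> sB; rewrite [leqRHS](narcs_setIDr B) (setIidPr sB) leq_addr.
Qed.

Lemma narcs_set1 x B : narcs [set x] B = #|[set y in B | e x y]|.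
Proof.
rewrite /narcs -(card_imset _ (f := fun y => (x, y))) => [|y y' [] //].
apply: eq_card => -[a b]; rewrite !inE /=; apply/and3P/imsetP.
  by case=> /eqP -> bB ab; exists b => //; rewrite inE bB.
by case=> y; rewrite inE => /andP[yB xy] [-> ->]; split.
Qed.

Hypotheses (e_sym : symmetric e) (e_irr : irreflexive e).

Lemma narcs_valent k x : valent k e -> narcs [set x] setT = k.
Proof.
move=> ek; rewrite narcs_set1 -[RHS](ek x).
by congr #|pred_of_set _|; apply/setP=> y; rewrite !inE.
Qed.

Lemma narcs_setT k X : valent k e -> narcs X setT = (k * #|X|)%N.
Proof.
move=> ek; have [n] := ubnP #|X|; elim: n X => // n IHn X.
have [->|[x xX]] := set_0Vmem X.
  rewrite cards0 muln0 => _; apply/eqP; rewrite cards_eq0; apply/eqP/setP=> z.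
  by rewrite !inE.
rewrite (cardsD1 x) xX => lt_n.
rewrite (narcs_setIDl [set x]) (setIidPr _) ?sub1set //.
rewrite (IHn (X :\ x)) //.
by rewrite (narcs_valent _ ek) -mulnS.
Qed.

(** A cut with fewer than [k] edges can be enlarged to a set of exactly
    [k - 1] edges, the form in which edge-connectivity is assumed, because
    [k] edges meet at any vertex. *)
Lemma edge_cut_ge k U :
  valent k e -> edge_connected k e -> U != set0 -> U != setT ->
  (k <= narcs U (~: U))%N.
Proof.
move=> ek econn /set0Pn[x xU] UnT; rewrite leqNgt; apply/negP=> small.
have /subsetPn[y _ yU] : ~~ (setT \subset U) by rewrite subTset.
pose pr (z : V * V) := [set z.1; z.2].
have sub_edges : pr @: arcs U (~: U) \subset edges e.
  apply/subsetP=> f /imsetP[[a b]]; rewrite !inE /= => /and3P[_ _ ab] ->.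
  by apply/existsP; exists a; apply/existsP; exists b; rewrite ab eqxx.
have star_edges : [set [set x; z] | z in [set z | e x z]] \subset edges e.
  apply/subsetP=> f /imsetP[z]; rewrite !inE /= => ab ->.
  by apply/existsP; exists x; apply/existsP; exists z; rewrite ab eqxx.
have big_edges : (k <= #|edges e|)%N.
  apply: leq_trans (subset_leq_card star_edges).
  rewrite card_in_imset ?ek // => a b; rewrite !inE => xa xb /setP/(_ a).
  rewrite !inE eqxx orbT; case: eqP => [ax|_ /= /esym /eqP //].
  by rewrite ax e_irr in xa.
pose F0 := pr @: arcs U (~: U).
have F0small : (#|F0| < k)%N by apply: leq_ltn_trans (leq_imset_card _ _) small.
have k_gt0 : (0 < k)%N by apply: leq_ltn_trans F0small.
have [F1 F1sub F1card] :
    exists2 F1 : {set {set V}},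
      F1 \subset edges e :\: F0 & #|F1| = (k.-1 - #|F0|)%N.
  apply: exists_subset_card; rewrite cardsDS // leq_sub2r //.
  exact: leq_trans (leq_pred _) big_edges.
have disjF : F0 :&: F1 = set0.
  apply/setP=> f; rewrite !inE; apply/negP=> /andP[fF0 /(subsetP F1sub)].
  by rewrite inE fF0.
have Fcard : #|F0 :|: F1|.+1 = k.
  by rewrite cardsU disjF cards0 F1card subn0 subnKC ?prednK // -ltnS prednK.
have Fsub : F0 :|: F1 \subset edges e.
  by rewrite subUset sub_edges (subset_trans F1sub) ?subsetDl.
have xy := econn _ Fsub Fcard x y.
have Uclosed : closed (del_edges e (F0 :|: F1)) (mem U).
  suff H a b : del_edges e (F0 :|: F1) a b -> a \in U -> b \in U.
    move=> a b ab; apply/idP/idP; first exact: H ab.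
    case/andP: ab => ab nF; apply: H; apply/andP.
    by rewrite e_sym setUC.
  move=> /andP[ab nF] aU; apply/negPn/negP=> bU; case/negP: nF.
  rewrite inE; apply/orP; left; apply/imsetP; exists (a, b) => //.
  by rewrite !inE /= aU bU.
have : (x \in U) = (y \in U) := closed_connect Uclosed xy.
by rewrite xU (negbTE yU).
Qed.

End Cuts.

(** * Two forces in the plane *)

Section Plane.
Variable R : realType.
Implicit Types (u v : 'rV[R]_2).

Definition det2 u v : R := u 0 0 * v 0 1 - u 0 1 * v 0 0.

Lemma rV2_eq u v : u 0 0 = v 0 0 -> u 0 1 = v 0 1 -> u = v.
Proof.
move=> E0 E1; apply/rowP=> i.
have [->//|->//] : i = 0 \/ i = 1.
by case: i => -[|[|//]] i2; [left | right]; apply: val_inj.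
Qed.

Lemma det2_eq0_scale d v : d != 0 -> det2 v d = 0 -> exists t, v = t *: d.
Proof.
move=> d0; rewrite /det2 => H.
have [d00|d00] := eqVneq (d 0 0) 0; last first.
  exists (v 0 0 / d 0 0); apply: rV2_eq; rewrite !mxE ?divfK //.
  by apply: (mulIf d00); rewrite mulrAC divfK //; lra.
have d1 : d 0 1 != 0.
  by apply: contra d0 => /eqP d1; apply/eqP/rV2_eq; rewrite ?mxE.
exists (v 0 1 / d 0 1); apply: rV2_eq; rewrite !mxE ?divfK //.
apply: (mulIf d1); move: H; rewrite d00 mulr0 subr0 => ->.
by rewrite mulr0 mul0r.
Qed.

Lemma collinear_dup u v : collinear u u v.
Proof.
have [->|vu] := eqVneq v u.
  exists u, (const_mx 1); split.
    by apply/eqP=> /rowP/(_ 0); rewrite !mxE => /eqP; rewrite oner_eq0.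
  by move=> q; rewrite !inE !orbb => /eqP ->; exists 0; rewrite scale0r addr0.
exists u, (v - u); split; first by rewrite subr_eq0.
move=> q; rewrite !inE => /or3P[] /eqP ->.
- by exists 0; rewrite scale0r addr0.
- by exists 0; rewrite scale0r addr0.
- by exists 1; rewrite scale1r addrC subrK.
Qed.

Lemma collinear_det2 u v q :
  u != v -> det2 (q - u) (v - u) = 0 -> collinear u v q.
Proof.
move=> uv H; have d0 : v - u != 0 by rewrite subr_eq0 eq_sym.
have [t Ht] := det2_eq0_scale d0 H.
exists u, (v - u); split=> // r; rewrite !inE => /or3P[] /eqP ->.
- by exists 0; rewrite scale0r addr0.
- by exists 1; rewrite scale1r addrC subrK.
- by exists t; rewrite -Ht addrC subrK.
Qed.

(** The force [a *: (u - v)] acts along the line [uv], and [a * det2 u v] is,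
    up to sign, its moment about the origin.  Two forces whose sum and
    total moment vanish act along the same line. *)
Lemma two_forces_collinear (a b : R) u v u' v' :
    u != v -> a != 0 ->
    a *: (u - v) + b *: (u' - v') = 0 -> a * det2 u v + b * det2 u' v' = 0 ->
  collinear u v u' /\ collinear u v v'.
Proof.
move=> uv a0 F M.
have F0 := congr1 (fun w : 'rV_2 => w 0 0) F.
have F1 := congr1 (fun w : 'rV_2 => w 0 1) F.
move: F0 F1 M; rewrite !mxE /det2 => F0 F1 M.
split; apply: collinear_det2 => //; rewrite /det2 !mxE.
  apply: (mulfI a0); move: (congr1 ( *%R (u' 0 1)) F0)
    (congr1 ( *%R (u' 0 0)) F1) M; lra.
apply: (mulfI a0); move: (congr1 ( *%R (v' 0 1)) F0)
  (congr1 ( *%R (v' 0 0)) F1) M; lra.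
Qed.

End Plane.

(** * Stresses and small cuts *)

Section Stresses.
Variables (R : realType) (V : finType) (e : rel V) (p : V -> 'rV[R]_2).
Hypotheses (V_gt2 : (2 < #|V|)%N) (p_gen : general_position p).
Implicit Types (w : V -> V -> R) (X Y Z : {set V}) (S T : {set V * V}).

(** Inside [Y] the terms cancel in pairs; only what crosses the cut is left. *)
Lemma antisym_cut_sum (h : V -> V -> R) Y :
    (forall x y, h x y = - h y x) ->
    (forall x, \sum_y h x y = 0) ->
  \sum_(x in Y) \sum_(y in ~: Y) h x y = 0.
Proof.
move=> anti bal.
have inner : \sum_(x in Y) \sum_(y in Y) h x y = 0.
  set s := LHS; have : s = - s.
    rewrite {1}/s exchange_big /= -sumrN; apply: eq_bigr => x _.
    by rewrite -sumrN; apply: eq_bigr => y _; exact: anti.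
  lra.
rewrite -[LHS]add0r -{1}inner -big_split /=; apply: big1 => x _.
rewrite -[RHS](bal x) [RHS](bigID (mem Y)) /=; congr (_ + _).
by apply: eq_bigl => y; rewrite inE.
Qed.

(** A stress is an element of the left kernel of the rigidity matrix, written
    as a symmetric function on pairs of vertices. *)
Definition stress w : Prop :=
  [/\ forall x y, w x y = w y x,
      forall x y, w x y != 0 -> e x y
    & forall x, \sum_y w x y *: (p x - p y) = 0].

(** The part of the framework on [Y] is in equilibrium, so the forces that the
    crossing edges exert on it have zero sum and zero total moment. *)
Lemma stress_cut_balance w Y (c := fun z : V * V => w z.1 z.2) :
  stress w ->
  \sum_(z in setX Y (~: Y)) c z *: (p z.1 - p z.2) = 0 /\
  \sum_(z in setX Y (~: Y)) c z * det2 (p z.1) (p z.2) = 0.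
Proof.
case=> wC _ bal.
have toX (f : V -> V -> R) : \sum_(z in setX Y (~: Y)) f z.1 z.2 =
    \sum_(x in Y) \sum_(y in ~: Y) f x y.
  by rewrite pair_big /=; apply: eq_bigl => z; rewrite !inE.
have coord i x : \sum_y w x y * (p x 0 i - p y 0 i) = 0.
  have /rowP/(_ i) := bal x; rewrite summxE mxE; apply: etrans.
  by apply: eq_bigr => y _; rewrite !mxE.
split.
  apply/rowP=> i; rewrite summxE mxE.
  under eq_bigr do rewrite !mxE.
  rewrite (toX (fun x y => w x y * (p x 0 i - p y 0 i))).
  apply: antisym_cut_sum => // x y.
  by rewrite (wC y x); lra.
rewrite (toX (fun x y => w x y * det2 (p x) (p y))).
apply: antisym_cut_sum => [x y|x]; first by rewrite (wC y x) /det2; lra.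
have E y : w x y * det2 (p x) (p y) =
    p x 0 1 * (w x y * (p x 0 0 - p y 0 0))
    - p x 0 0 * (w x y * (p x 0 1 - p y 0 1)).
  by rewrite /det2; ring.
under eq_bigr do rewrite E.
by rewrite sumrB -!mulr_sumr !coord; lra.
Qed.

Lemma general_position_inj : injective p.
Proof.
move=> x y pxy; apply/eqP/negPn/negP=> xy.
have /subsetPn[z _ zxy] : ~~ ([set: V] \subset [set x; y]).
  apply: contraL V_gt2 => /subset_leq_card; rewrite cardsT cards2 xy.
  by rewrite -leqNgt.
apply: (@p_gen x y z); last by rewrite -pxy; apply: collinear_dup.
move: zxy; rewrite /= !inE !negb_or => /andP[zx zy].
by rewrite xy (eq_sym x) zx (eq_sym y) zy.
Qed.

(** Two distinct crossing edges involve at least three vertices, so they lie on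
    different lines, and forces along them cannot balance. *)
Lemma stress_small_cut w Y :
    stress w ->
    (#|[set z in setX Y (~: Y) | w z.1 z.2 != 0%R]| <= 2)%N ->
  forall y z, y \in Y -> z \notin Y -> w y z = 0.
Proof.
move=> wS small y z yY zY; apply/eqP/negPn/negP=> wyz.
have [F M] := stress_cut_balance Y wS.
pose Q := [set z in setX Y (~: Y) | w z.1 z.2 != 0%R].
have toQ (W : nmodType) (f : V * V -> W) :
    (forall z, w z.1 z.2 = 0 -> f z = 0) ->
  \sum_(z in setX Y (~: Y)) f z = \sum_(z in Q) f z.
  move=> f0; rewrite big_mkcond [RHS]big_mkcond; apply: eq_bigr => q _.
  rewrite [in RHS]inE; case: ifP => //= _.
  by case: eqP => // /f0.
move: F M; rewrite !toQ => [|q ->|q ->]; rewrite ?mul0r ?scale0r //.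
have yzQ : (y, z) \in Q by rewrite !inE /= yY zY.
have nyz : y != z by apply: contraNneq zY => <-.
have pyz : p y != p z by rewrite (inj_eq general_position_inj).
rewrite (big_setD1 _ yzQ) [X in _ -> X = _ -> _](big_setD1 _ yzQ) /=.
have [->|[[y' z'] q'Q]] := set_0Vmem (Q :\ (y, z)).
  rewrite !big_set0 !addr0 => /eqP; rewrite scaler_eq0 subr_eq0.
  by rewrite (negbTE wyz) (negbTE pyz).
have -> : Q :\ (y, z) = [set (y', z')].
  apply/esym/eqP; rewrite eqEcard sub1set q'Q cards1.
  by move: small; rewrite (cardsD1 (y, z)) yzQ.
rewrite !big_set1 /= => F M.
have [C1 C2] := two_forces_collinear pyz wyz F M.
move: q'Q; rewrite !inE /= => /andP[ne /andP[/andP[y'Y z'Y] _]].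
have yz' : y != z' by apply: contraNneq z'Y => <-.
have zy' : z != y' by apply: contraNneq zY => ->.
have [eyy'|nyy'] := eqVneq y' y.
  apply: (p_gen _ C2); rewrite /= !inE negb_or nyz yz' andbT /=.
  by rewrite andbT; apply: contra ne => /eqP ->; rewrite eyy'.
by apply: (p_gen _ C1); rewrite /= !inE negb_or nyz zy' eq_sym nyy'.
Qed.

(** As a stress is determined by its values on [S], this bounds by [#|S|] the
    dimension of the space of stresses supported in [X]. *)
Definition forces X S : Prop :=
  forall w, stress w -> (forall x y, w x y != 0 -> (x \in X) && (y \in X)) ->
  (forall z, z \in S -> w z.1 z.2 = 0) -> forall x y, w x y = 0.

Lemma forces_set1 x : irreflexive e -> forces [set x] set0.
Proof.
move=> e_irr w [_ w_e _] wx _ a b; apply/eqP/negPn/negP=> wab.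
by move: (wx _ _ wab) (w_e _ _ wab); rewrite !inE => /andP[/eqP -> /eqP ->];
   rewrite e_irr.
Qed.

(** Balance survives at the vertices of [Y] because nothing nonzero is cut
    off. *)
Lemma stress_restrict w Y :
    stress w -> (forall y z, y \in Y -> z \notin Y -> w y z = 0) ->
  stress (fun x y => if (x \in Y) && (y \in Y) then w x y else 0).
Proof.
move=> [wC w_e bal] cut0; split=> [x y|x y|x].
- by rewrite andbC wC.
- by case: ifP => [_|_]; [exact: w_e | rewrite eqxx].
- have [xY|xY] /= := boolP (x \in Y); last first.
    by rewrite big1 // => y _; rewrite scale0r.
  rewrite -[RHS](bal x); apply: eq_bigr => y _.
  by have [//|yY] := boolP (y \in Y); rewrite cut0.
Qed.

(** A stress that vanishes on [T] has at most two nonzero values across the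
    cut, so it vanishes on the whole cut and is the sum of its restrictions to
    the two sides. *)
Lemma forces_split X Y S1 S2 T :
    Y \subset X -> (#|arcs e Y (X :\: Y) :\: T| <= 2)%N ->
    forces Y S1 -> forces (X :\: Y) S2 -> forces X (S1 :|: S2 :|: T).
Proof.
move=> YX small fY fZ w wS wX w0.
have [wC w_e bal] := wS.
have cut0 y z : y \in Y -> z \notin Y -> w y z = 0.
  apply: stress_small_cut => //; apply: leq_trans small.
  apply/subset_leq_card/subsetP=> -[a b]; rewrite !inE /=.
  case/andP=> /andP[aY bY] wab.
  rewrite aY bY (w_e _ _ wab); case/andP: (wX _ _ wab) => _ -> /=.
  rewrite andbT; apply: contra wab => abT; apply/eqP.
  by apply: (w0 (a, b)); rewrite !inE abT !orbT.
have cut0' y z : y \in X :\: Y -> z \notin X :\: Y -> w y z = 0.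
  rewrite !inE => /andP[yY yX]; rewrite negb_and negbK => /orP[zY|zX].
    by rewrite wC cut0.
  by apply/eqP/negPn/negP=> /wX; rewrite (negbTE zX) andbF.
have zeroY := fY _ (stress_restrict wS cut0).
have zeroZ := fZ _ (stress_restrict wS cut0').
move=> x y; apply/eqP/negPn/negP=> wxy.
have /andP[xX yX] := wX _ _ wxy.
have [xY|xY] := boolP (x \in Y).
  have yY : y \in Y by apply: contraNT wxy => yY; rewrite cut0.
  case/eqP: wxy; have := zeroY _ _ x y; rewrite xY yY; apply.
    by move=> a b; case: ifP => //; rewrite eqxx.
  by move=> z zS; case: ifP => // _; apply: w0; rewrite !inE zS.
have yY : y \notin Y by apply: contraNN wxy => yY; rewrite wC cut0.
case/eqP: wxy; have := zeroZ _ _ x y; rewrite !inE xY yY xX yX; apply.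
  by move=> a b; case: ifP => //; rewrite eqxx.
by move=> z zS; case: ifP => // _; apply: w0; rewrite !inE zS orbT.
Qed.

Definition forceable X m : Prop := exists2 S, forces X S & (#|S| <= m)%N.

Lemma forceable_set1 x : irreflexive e -> forceable [set x] 0.
Proof. by move=> e_irr; exists set0; [exact: forces_set1 | rewrite cards0]. Qed.

(** Each edge of the cut beyond the second costs one more forcing edge. *)
Lemma forceable_split X Y m1 m2 k :
    Y \subset X -> (narcs e Y (X :\: Y) <= k.+2)%N ->
    forceable Y m1 -> forceable (X :\: Y) m2 -> forceable X (m1 + m2 + k).
Proof.
rewrite /narcs => YX; set D := arcs _ _ _ => small [S1 f1 c1] [S2 f2 c2].
have [T TD cT] : exists2 T : {set V * V}, T \subset D & #|T| = minn k #|D|.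
  by apply: exists_subset_card; rewrite geq_minr.
exists (S1 :|: S2 :|: T).
  apply: (forces_split YX _ f1 f2).
  by rewrite cardsDS // cT leq_subLR addn_minl leq_min addn2 small leq_addr.
apply: leq_trans (leq_card_setU _ _) (leq_add _ _); last by rewrite cT geq_minl.
exact: leq_trans (leq_card_setU _ _) (leq_add c1 c2).
Qed.

End Stresses.

(** * Few edges force all stresses *)

Section Bound.
Variables (R : realType) (V : finType) (e : rel V) (p : V -> 'rV[R]_2).
Hypotheses (e_sym : symmetric e) (e_irr : irreflexive e).
Hypotheses (e_val4 : valent 4 e) (e_econn4 : edge_connected 4 e).
Hypotheses (V_gt2 : (2 < #|V|)%N) (p_gen : general_position p).
Implicit Types (U X Y Z : {set V}).

(** The natural bound on [m] is a third of the sum of [2 e(P) - 3 #|P| + 3]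
    over the parts [P] left when [X] is split along cuts of at most two edges,
    [e(P)] being the number of edges inside [P].
    The parts never need to be named: they only matter through a lower bound on
    the cuts that separate them from some larger set [Z], and with [Z] and the
    excess [t] of these cuts over [3] left free the bound passes through the
    induction.  When no small cut exists, the induction hypothesis for
    [X :\ x] is used with [Z := X], where the absence of small cuts in [X] is
    exactly its hypothesis. *)
Lemma exists_forceable_bound X :
    X != set0 -> X != setT ->
  exists2 m, forceable e p X m &
    forall Z t, X \subset Z ->
      (forall U, U \subset X -> U != set0 -> (t + 3 <= narcs e U (Z :\: U))%N) ->
    (3 * m + 3 * #|X| + t <= narcs e X Z)%N.
Proof.
have [n] := ubnP #|X|; elim: n X => // n IHn X lt_n X0 XT.
have nT (W : {set V}) : W \subset X -> W != setT.
  by move=> WX; apply: contraNneq XT => WT; rewrite -subTset -WT.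
(* Either a cut of at most two edges splits the stresses at no cost, or none
   exists and one forced edge frees a vertex of degree 3. *)
have [/existsP[Y /and4P[YX Y0 YnX small]]|dense] :=
    boolP [exists Y : {set V},
      [&& Y \subset X, Y != set0, Y != X & (narcs e Y (X :\: Y) <= 2)%N]].
  have ltY : (#|Y| < #|X|)%N by rewrite proper_card // properEneq YnX.
  have cX : #|X| = (#|Y| + #|X :\: Y|)%N.
    by rewrite -(cardsID Y X) (setIidPr YX).
  have ltZ : (#|X :\: Y| < #|X|)%N.
    by rewrite cX -[ltnLHS]add0n ltn_add2r card_gt0.
  have Z0 : X :\: Y != set0.
    by rewrite setD_eq0; apply: contraNN YnX => XY; rewrite eqEsubset YX.
  have [m1 f1 b1] := IHn Y (leq_trans ltY lt_n) Y0 (nT _ YX).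
  have [m2 f2 b2] :=
    IHn (X :\: Y) (leq_trans ltZ lt_n) Z0 (nT _ (subsetDl _ _)).
  exists (m1 + m2 + 0)%N; first exact: (forceable_split V_gt2 p_gen YX).
  move=> Z t XZ ZU.
  have := b1 Z t (subset_trans YX XZ) (fun U UY => ZU U (subset_trans UY YX)).
  have := b2 Z t (subset_trans (subsetDl _ _) XZ)
             (fun U UY => ZU U (subset_trans UY (subsetDl _ _))).
  rewrite cX (narcs_setIDl e Y X) (setIidPr YX); lia.
have dense3 U : U \subset X -> U != set0 -> U != X ->
    (3 <= narcs e U (X :\: U))%N.
  move=> UX U0 UnX; rewrite ltnNge; apply: contra dense => small.
  by apply/existsP; exists U; apply/and4P.
(* An edge leaving [X] supplies a vertex [x] with at most three neighbours
   in [X]. *)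
have : (0 < narcs e X (~: X))%N.
  exact: leq_trans (edge_cut_ge e_sym e_irr e_val4 e_econn4 X0 XT).
case/card_gt0P=> -[x x']; rewrite !inE /= => /and3P[xX x'X xx'].
have dx : (narcs e [set x] X <= 3)%N.
  have := narcs_valent x e_val4.
  rewrite (narcs_setIDr e X) setTI.
  suff : (0 < narcs e [set x] (setT :\: X))%N by lia.
  by apply/card_gt0P; exists (x, x'); rewrite !inE /= eqxx x'X.
have cX : #|X| = #|X :\ x|.+1 by rewrite (cardsD1 x) xX.
have ltx : (#|X :\ x| < #|X|)%N by rewrite cX.
have [X1|X1] := eqVneq (X :\ x) set0.
  have EX : X = [set x].
    by apply/eqP; rewrite eqEsubset sub1set xX -setD_eq0 X1 eqxx.
  exists 0%N; first by rewrite EX; apply: forceable_set1.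
  move=> Z t XZ /(_ X (subxx _) X0).
  rewrite EX cards1 (narcs_setIDr e [set x] _ Z); lia.
have [m f b] := IHn (X :\ x) (leq_trans ltx lt_n) X1 (nT _ (subsetDl _ _)).
exists (0 + m + 1)%N.
  apply: (forceable_split V_gt2 p_gen _ _ (forceable_set1 p x e_irr) f).
    by rewrite sub1set.
  exact: leq_trans (leq_narcsr _ _ (subsetDl _ _)) dx.
move=> Z t XZ ZU.
have {b} : (3 * m + 3 * #|X :\ x| + 0 <= narcs e (X :\ x) X)%N.
  apply: b => [|U UX U0]; first exact: subsetDl.
  apply: dense3 => //; first exact: subset_trans UX (subsetDl _ _).
  by apply: contraTneq UX => ->; apply/subsetPn; exists x; rewrite ?inE ?eqxx.
have d3 : (3 <= narcs e [set x] X)%N.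
  apply: leq_trans (leq_narcsr _ _ (subsetDl _ [set x])); apply: dense3.
  - by rewrite sub1set.
  - by rewrite -card_gt0 cards1.
  - by apply: contraNneq X1 => <-; rewrite setDv.
have := ZU X (subxx _) X0.
rewrite (narcs_setIDr e X X Z) (setIidPr XZ).
rewrite (narcs_setIDl e [set x] X X) (setIidPr _) ?sub1set // cX.
lia.
Qed.

(** Removing one vertex costs two forced edges.  All cuts have at least four
    edges, so the rest is counted with [Z] the whole graph and [t := 1]. *)
Lemma exists_forceable_setT :
  exists2 m, forceable e p setT m & (3 * m <= #|V| + 4)%N.
Proof.
have /card_gt0P[x _] : (0 < #|V|)%N by lia.
have cX : #|[set~ x]| = #|V|.-1 by rewrite cardsC1.
have X0 : [set~ x] != set0 by rewrite -card_gt0 cX; lia.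
have XT : [set~ x] != setT.
  by apply/eqP=> /setP/(_ x); rewrite !inE eqxx.
have [m f b] := exists_forceable_bound X0 XT.
exists (0 + m + 2)%N.
  apply: (forceable_split V_gt2 p_gen _ _ (forceable_set1 p x e_irr)).
  - exact: subsetT.
  - apply: leq_trans (leq_narcsr _ _ (subsetT _)) _.
    by rewrite (narcs_valent _ e_val4).
  - by rewrite setTD.
have /b : [set~ x] \subset setT by apply: subsetT.
move/(_ 1%N); rewrite (narcs_setT _ e_val4) cX => bound.
suff : (3 * m + 3 * #|V|.-1 + 1 <= 4 * #|V|.-1)%N by lia.
apply: bound => U Ux U0; rewrite setTD.
apply: (edge_cut_ge e_sym e_irr) => //; apply: contraTneq Ux => ->.
by apply/subsetPn; exists x; rewrite !inE ?eqxx.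
Qed.

End Bound.

(** * From stresses to the rank *)

Section Rank.
Variables (R : realType) (V : finType) (e : rel V) (p : V -> 'rV[R]_2).
Hypotheses (e_sym : symmetric e) (e_irr : irreflexive e).
Implicit Types (u : 'rV[R]_(#|edges e|)).

(** The sum has one term if [f] is an edge and none otherwise, so the weight
    vanishes off the edges. *)
Definition edge_weight u (f : {set V}) : R :=
  \sum_(i < #|edges e| | enum_val i == f) u 0 i.

Lemma edge_weight_val u i : edge_weight u (enum_val i) = u 0 i.
Proof.
rewrite /edge_weight (big_pred1 i) // => j.
exact: (inj_eq enum_val_inj).
Qed.

Lemma mem_edges x y : ([set x; y] \in edges e) = e x y.
Proof.
rewrite inE; apply/existsP/idP=> [[a /existsP[b /andP[ab /eqP E]]]|xy].
  have nab : a != b by apply: contraTneq ab => ->; rewrite e_irr.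
  have : a \in [set x; y] by rewrite E !inE eqxx.
  have : b \in [set x; y] by rewrite E !inE eqxx orbT.
  rewrite !inE => /orP[] /eqP Eb /orP[] /eqP Ea; subst a b;
    rewrite ?eqxx // in nab *; by rewrite // e_sym.
by exists x; apply/existsP; exists y; rewrite xy eqxx.
Qed.

(** The column of the rigidity matrix at [x] only sees the edges [[set x; y]],
    which turns the vanishing of [u *m R] at [x] into balance at [x]. *)
Lemma stress_of_kernel u :
  u *m rigidity_matrix e p = 0 ->
  stress e p (fun x y => edge_weight u [set x; y]).
Proof.
move=> uR.
have supp x y : ~~ e x y -> edge_weight u [set x; y] = 0.
  move=> nxy; rewrite /edge_weight big1 // => i /eqP E.
  by case/negP: nxy; rewrite -mem_edges -E enum_valP.
split=> [x y|x y|x]; first by rewrite setUC.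
  by apply: contraR => /supp ->.
have bal : \sum_(f in edges e) edge_weight u f *: rigidity_block p f x = 0.
  rewrite big_enum_val /=.
  have /(congr1 vec_mx) := uR; rewrite mulmx_sum_row linear_sum linear0.
  move/(congr1 (row (enum_rank x))); rewrite linear_sum linear0 => {2}<-.
  apply: eq_bigr => i _; rewrite edge_weight_val !linearZ rowK /= mxvecK rowK.
  by rewrite enum_rankK.
rewrite -[RHS]bal (bigID (fun y => e x y)) /= [X in _ + X]big1 => [|y nxy];
  last by rewrite supp // scale0r.
rewrite addr0 [RHS](bigID (fun f : {set V} => x \in f)) /=.
rewrite [X in _ = _ + X]big1 => [|f /andP[_ xf]]; last first.
  by rewrite /rigidity_block (negbTE xf) scaler0.
rewrite addr0 [RHS](eq_bigl (mem [set [set x; y] | y in [set y | e x y]])).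
  rewrite big_imset /=.
    apply: eq_big => [y|y xy]; first by rewrite inE.
    have nxy : x != y by apply: contraTneq xy => ->; rewrite e_irr.
    by rewrite rigidity_blockE // eqxx.
  move=> y z; rewrite !inE => xy xz /setP/(_ y).
  rewrite !inE eqxx orbT; case: eqP => [yx|_ /= /esym/eqP //].
  by rewrite yx e_irr in xy.
move=> f; apply/andP/imsetP=> [[]|[y]]; last first.
  by rewrite inE => xy ->; rewrite mem_edges xy !inE eqxx.
rewrite inE => /existsP[a /existsP[b /andP[ab /eqP ->]]].
rewrite !inE => /orP[] /eqP ->; first by exists b; rewrite ?inE.
by exists a; rewrite ?inE 1?setUC // e_sym.
Qed.

(** Adjoining to the rigidity matrix one indicator column per forcing edge
    makes its rows independent. *)
Lemma card_edges_le_rank m :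
  forceable e p setT m -> (#|edges e| <= \rank (rigidity_matrix e p) + m)%N.
Proof.
case=> S fS cS; set A := rigidity_matrix e p.
pose B : 'M[R]_(#|edges e|, #|S|) :=
  \matrix_(i, j) (enum_val i == [set (enum_val j).1; (enum_val j).2])%:R.
have free : row_free (row_mx A B).
  rewrite -kermx_eq0; apply/rowV0P => u /sub_kermxP.
  rewrite mul_mx_row => /eqP; rewrite row_mx_eq0 => /andP[/eqP uA /eqP uB].
  have u0 := fS _ (stress_of_kernel uA).
  apply/rowP=> i; rewrite mxE -edge_weight_val.
  have := enum_valP i; rewrite inE => /existsP[a /existsP[b /andP[_ /eqP ->]]].
  apply: u0 => [x y _|z zS]; first by rewrite !inE.
  have /rowP/(_ (enum_rank_in zS z)) := uB; rewrite !mxE => <-.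
  rewrite /edge_weight big_mkcond; apply: eq_bigr => j _.
  by rewrite !mxE enum_rankK_in //; case: eqP; rewrite ?mulr1 ?mulr0.
have : (\rank (row_mx A B) <= \rank A + \rank B)%N.
  rewrite -mxrank_tr tr_row_mx -(mxrank_tr A) -(mxrank_tr B) -addsmxE.
  by rewrite mxrank_adds_leqif.
rewrite (eqP free) => /leq_trans; apply.
by rewrite leq_add2l (leq_trans (rank_leq_col _)).
Qed.

Lemma card_edges_valent k : valent k e -> (#|edges e| * 2 = k * #|V|)%N.
Proof.
move=> ek; rewrite -cardsT -(narcs_setT setT ek).
pose pr (z : V * V) := [set z.1; z.2].
rewrite /narcs -[RHS]sum1_card [RHS](partition_big pr (mem (edges e))) /=;
  last first.
  by case=> a b; rewrite inE /= => /and3P[_ _ ab]; rewrite mem_edges.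
rewrite -sum_nat_const; apply: eq_bigr => f; rewrite inE =>
  /existsP[a /existsP[b /andP[ab /eqP ->]]].
have nab : a != b by apply: contraTneq ab => ->; rewrite e_irr.
rewrite [RHS](eq_bigl (mem [set (a, b); (b, a)])) ?sum1_card => [|[x y]].
  by rewrite cards2 xpair_eqE (negbTE nab).
rewrite !inE /= !xpair_eqE; apply/andP/orP=> [[xy /eqP E]|].
  have nxy : x != y by apply: contraTneq xy => ->; rewrite e_irr.
  have : x \in pr (x, y) by rewrite !inE eqxx.
  have : y \in pr (x, y) by rewrite !inE eqxx orbT.
  rewrite E !inE => /orP[] /eqP Ey /orP[] /eqP Ex; subst x y;
    by rewrite ?eqxx in nxy *; auto.
by case=> /andP[/eqP -> /eqP ->]; rewrite ?ab // e_sym ab /pr setUC.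
Qed.

End Rank.

Theorem theorem1p4 (R : realType) (V : finType) (e : rel V)
    (e_sym : symmetric e) (e_irr : irreflexive e)
    (e_conn : graph_connected e) (e_val4 : valent 4 e)
    (e_econn4 : edge_connected 4 e)
    (p : V -> 'rV[R]_2) (p_gen : general_position p) :
  (\rank (rigidity_matrix e p))%:R >= (5 * #|V|%:R - 4) / 3 :> R.
Proof.
have cE := card_edges_valent e_sym e_irr e_val4.
have [V_le2|V_gt2] := leqP #|V| 2.
  have V0 : #|V| = 0%N.
    apply/eqP; rewrite -leqn0 leqNgt; apply/negP=> /card_gt0P[x _].
    have : (#|[set y | e x y]| <= #|V|)%N := max_card _.
    by rewrite e_val4 => /leq_trans/(_ V_le2).
  have -> : #|V|%:R = 0 :> R by rewrite V0.
  by apply: (le_trans _ (ler0n _ _)); lra.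
have [m fm cm] := exists_forceable_setT e_sym e_irr e_val4 e_econn4 V_gt2 p_gen.
have rk := card_edges_le_rank e_sym e_irr fm.
have : (5 * #|V| <= 3 * \rank (rigidity_matrix e p) + 4)%N by lia.
by rewrite -(ler_nat R) natrD !natrM; lra.
Qed.
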